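(* For all positive integers $n$ and integers $k\ge 2$, we have $$\det_{0\le i,j\le n-1}\left(\mathcal P_{j+1}(i,k)+t(xy)^{i}\mathcal P_{j+1}(-i,k)\right)$$ $$=\begin{cases} (-1)^{k(n_1-1)-1}(1+t)\,t^{kn_1-2}(xy)^{kn_1(2kn_1-k-3)+k}\,P_{n-k+2,k}(x,y,t) & \text{if } n=2kn_1-1,\\ (-1)^{kn_1+\binom k2}(1+t)\,t^{k(n_1-1)}(xy)^{k(n_1-1)(2kn_1-k+1)}\,P_{n,k}(x,y,t) & \text{if } n=2kn_1-k+1,\\ (-1)^{kn_1+\binom{k+1}2}(1+t)\,t^{k(n_1-1)}(xy)^{k(n_1-1)(2kn_1-k-1)}\,P_{n-k,k}(x,y,t) & \text{if } n=2kn_1-k,\\ (-1)^{kn_1}(1+t)\,t^{kn_1-1}(xy)^{kn_1(2kn_1-k-1)}\,P_{n,k}(x,y,t) & \text{if } n=2kn_1,\\ 0 & \text{if } n\not\equiv 0,k,k+1,2k-1\pmod{2k},\end{cases}$$ where $n_1$ denotes a positive integer and, for all integers $m\ge0$, $k\ge1$, $$P_{m,k}(x,y,t)=\begin{cases} \displaystyle\sum_{s=0}^{m/k}(-1)^s t^{\min\{s,\frac mk-s\}}x^{sk}y^{m-sk} & \text{if } m\equiv 0\pmod k,\\[3mm] \displaystyle\sum_{s=0}^{\lfloor m/k\rfloor}(-1)^s t^{\min\{s,\lceil m/k\rceil-s\}}\left(x^{sk}y^{m-sk}+x^{m-sk}y^{sk}\right) & \text{if } m\not\equiv 0\pmod k,\end{cases}$$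 while for $k=1$ we have $$\det_{0\le i,j\le n-1}\left(\mathcal P_{j+1}(i,1)+t(xy)^{i}\mathcal P_{j+1}(-i,1)\right)=\begin{cases} (-1)^{n_1+1}(1+t)\,t^{n_1-1}(xy)^{2(n_1-1)^2}\,P_{n-1,1}(x,y,t) & \text{if } n=2n_1-1,\\ (-1)^{n_1}(1+t)\,t^{n_1-1}(xy)^{2n_1(n_1-1)}\,P_{n,1}(x,y,t) & \text{if } n=2n_1,\end{cases}$$ and for $k=0$ we have $$\det_{0\le i,j\le n-1}\left(\mathcal P_{j+1}(i,0)+t(xy)^{i}\mathcal P_{j+1}(-i,0)\right)=(1+t)^n(xy)^{\binom n2}(x^n+y^n).$$
   Context: $x,y,t$ are indeterminates. A three-step path is a lattice path in $\mathbb Z^2$ consisting of steps from $\{(1,0),(1,1),(1,-1)\}$. The steps have weights $w((1,0))=x+y$, $w((1,1))=1$, $w((1,-1))=xy$, and the weight $w(P)$ of a path $P$ is the product of the weights of its steps (the empty path has weight $1$). For integers $n\ge 0$ and $l,k$ (possibly negative), $\mathcal P_n(l,k)=\sum_P w(P)$, where the sum is over all three-step paths $P$ from $(0,l)$ to $(n,k)$ (with no restriction about the $x$-axis). For $k=2$ the first two cases of the first formula coincide and give the same value. In the matrices, $i$ is the row index and $j$ the column index. *)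

(* Defs.v *)
From mathcomp Require Import all_boot all_order all_algebra.
From mathcomp.multinomials Require Import mpoly.

Set Implicit Arguments.
Unset Strict Implicit.
Unset Printing Implicit Defensive.

Import Order.TTheory GRing.Theory Num.Theory.
Local Open Scope ring_scope.

Definition three_steps : seq (int * int) := [:: (1, 0); (1, 1); (1, -1)].

Notation step := (seq_sub three_steps).

Definition step_vec (s : step) : int * int := ssval s.

(* The point reached from a by the path with successive steps p. *)
Definition path_end (a : int * int) (p : seq step) : int * int :=
  a + \sum_(s <- p) step_vec s.

Definition step_weight (R : comNzRingType) (x y : R) (s : step) : R :=
  if step_vec s == (1, 0) then x + y
  else if step_vec s == (1, 1) then 1
  else x * y.

Definition path_weight (R : comNzRingType) (x y : R) (p : seq step) : R :=
  \prod_(s <- p) step_weight x y s.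

(* Every step increases the abscissa by 1, so a path from (0, l) to (n, k) has
   exactly n steps; summing over n.-tuples therefore loses no path. *)
Definition path_sum (R : comNzRingType) (x y : R) (n : nat) (l k : int) : R :=
  \sum_(p : n.-tuple step | path_end (0, l) p == (n%:Z, k)) path_weight x y p.

Definition ceil_div (m k : nat) : nat := ((m + k.-1) %/ k)%N.

(* P_{m,k}(x,y,t), for k >= 1.  The summation ranges are inclusive, and no
   truncated subtraction below is ever negative. *)
Definition Ppol (R : comNzRingType) (m k : nat) (x y t : R) : R :=
  if (k %| m)%N then
    \sum_(0 <= s < (m %/ k).+1)
      (-1) ^+ s * t ^+ minn s (m %/ k - s) * x ^+ (s * k) * y ^+ (m - s * k)
  else
    \sum_(0 <= s < (m %/ k).+1)
      (-1) ^+ s * t ^+ minn s (ceil_div m k - s)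
      * (x ^+ (s * k) * y ^+ (m - s * k) + x ^+ (m - s * k) * y ^+ (s * k)).

Definition path_mx (R : comNzRingType) (x y t : R) (n : nat) (k : int)
  : 'M[R]_n :=
  \matrix_(i < n, j < n)
    (path_sum x y j.+1 i%:Z k + t * (x * y) ^+ i * path_sum x y j.+1 (- i%:Z) k).

(* The three indeterminates x, y, t of Z[x, y, t]. *)
Definition X : {mpoly int[3]} := 'X_(@Ordinal 3 0 isT).
Definition Y : {mpoly int[3]} := 'X_(@Ordinal 3 1 isT).
Definition T : {mpoly int[3]} := 'X_(@Ordinal 3 2 isT).

(* Main.v *)
(* Let f = z + (x + y) + x y / z and e_a = z^a + (x y / z)^a for a > 0, e_0 = 1.
   Entry (i, j) of the matrix is the coefficient of z^k in
   (z^i + t (x y / z)^i) f^(j+1).  The powers f^0, ..., f^n and the e_0, ..., e_n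
   are related by a unitriangular matrix, and every f^j with j > 0 vanishes at
   z = - x, so up to sign the determinant is that of the matrix of order n + 1
   whose last row lists the values e_a(- x) and whose row i < n has just the two
   nonzero entries (x y)^(i-k) (or 1) in column |i - k| and t (x y)^i in column
   i + k.
   Rows linking columns |i - k| and i + k form chains modulo 2k.  If some chain
   has more rows than columns the determinant vanishes.  Otherwise one chain
   carries an explicit kernel vector of the first n rows; pairing it with the
   last row gives the polynomial P_{m,k}, and the remaining cofactor is computed
   by peeling off 2k rows and columns at a time. *)

Require Import Defs.
From HB Require Import structures.
From mathcomp Require Import all_boot all_order all_algebra.
From mathcomp.multinomials Require Import mpoly.
From mathcomp Require Import perm zify ring.

Set Implicit Arguments.
Unset Strict Implicit.
Unset Printing Implicit Defensive.

Import Order.TTheory GRing.Theory Num.Theory.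
Local Open Scope ring_scope.

(** * First-step recursion for path sums *)

Lemma big_step (R : nmodType) (F : int * int -> R) :
  \sum_(s : Defs.step) F (step_vec s) = F (1, 0) + F (1, 1) + F (1, -1).
Proof.
rewrite -(big_map (@ssval _ three_steps) xpredT F) (perm_big three_steps) /=.
  by rewrite !big_cons big_nil addr0 addrA.
apply: uniq_perm => [||v] //.
  by rewrite map_inj_uniq ?index_enum_uniq //; exact: val_inj.
apply/mapP/idP => [[s _ ->]|v_step]; first exact: ssvalP.
by exists (SeqSub v_step); rewrite ?mem_index_enum.
Qed.

Section PathSum.
Variables (R : comNzRingType) (x y : R).

Lemma path_sum0 (l k : int) : path_sum x y 0 l k = (k - l == 0)%:R.
Proof.
rewrite /path_sum big_mkcond (big_pred1 [tuple]) => [|p]; last first.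
  by rewrite (tuple0 p); apply/esym/eqP.
rewrite /path_end /path_weight !big_nil addr0 xpair_eqE /= subr_eq0 eq_sym.
by case: (k == l).
Qed.

Lemma path_sumS (n : nat) (l k : int) :
  path_sum x y n.+1 l k =
  (x + y) * path_sum x y n l k + path_sum x y n (l + 1) k
  + x * y * path_sum x y n (l - 1) k.
Proof.
rewrite /path_sum.
rewrite (reindex (fun p : Defs.step * n.-tuple Defs.step => cons_tuple p.1 p.2)) /=;
  last first.
  exists (fun p => (thead p, [tuple of behead p])) => [[s p] _|p _] /=.
    by rewrite theadE; congr (_, _); apply: val_inj.
  by apply: val_inj; rewrite /= [in RHS](tuple_eta p).
(* [F v] gathers the paths whose first step has vector [v]; depending on the vector alone, it can be
   enumerated by [big_step]. *)
pose F (v : int * int) :=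
  \sum_(p : n.-tuple Defs.step | path_end ((0, l) + v) p == (n.+1%:Z, k))
  (if v == (1, 0) then x + y else if v == (1, 1) then 1 else x * y) * path_weight x y p.
rewrite big_mkcond.
rewrite -(pair_bigA _ (fun (s : Defs.step) (p : n.-tuple Defs.step) =>
  if path_end (0, l) (s :: p) == (n.+1%:Z, k) then path_weight x y (s :: p) else 0)) /=.
transitivity (\sum_(s : Defs.step) F (step_vec s)).
  apply: eq_bigr => s _; rewrite /F -big_mkcond; apply: eq_big => p.
    by rewrite /path_end big_cons addrA.
  by rewrite /path_weight big_cons.
have shift (h : int) (p : seq Defs.step) :
    (path_end ((0, l) + (1, h)) p == (n.+1%:Z, k)) =
    (path_end (0, l + h) p == (n%:Z, k)).
  have -> : (0, l) + (1, h) = (1, 0) + (0, l + h) :> (int * int)%type.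
    by apply/eqP; rewrite xpair_eqE /=; lia.
  have -> : (n.+1%:Z, k) = (1, 0) + (n%:Z, k) :> (int * int)%type.
    by apply/eqP; rewrite xpair_eqE /= ; lia.
  by rewrite /path_end -addrA (inj_eq (addrI _)).
rewrite big_step; congr (_ + _ + _); rewrite /F ?mulr_sumr;
  by apply: eq_big => p; rewrite ?shift ?addr0 ?mul1r.
Qed.
End PathSum.

(** * Powers of f in the basis e_a *)

Lemma big_ord_recl_nat (V : nmodType) (F : nat -> V) (m : nat) :
  \sum_(a < m.+1) F a = F 0 + \sum_(a < m) F a.+1.
Proof. by rewrite big_ord_recl; congr (_ + _); apply: eq_bigr. Qed.

Section Coefficients.
Variables (R : comNzRingType) (x y : R).
Local Notation q := (x * y).

(* With [f = z + (x + y) + q / z] and [e_a = z^a + (q / z)^a] for [a > 0],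
   [e_0 = 1], [fcoef j a] is the coefficient of [e_a] in [f^j]. *)
Fixpoint fcoef (j a : nat) : R :=
  if j is j'.+1 then
    (x + y) * fcoef j' a
    + (if a is a'.+1 then fcoef j' a' else q * fcoef j' 1)
    + q * fcoef j' a.+1
  else (a == 0)%:R.

Lemma fcoef_gt (j a : nat) : (j < a)%N -> fcoef j a = 0.
Proof.
elim: j a => [|j IHj] [|a] //= lt_ja.
by rewrite !IHj ?mulr0 ?addr0 // ltnW // ltnW.
Qed.

Lemma fcoef_diag (j : nat) : fcoef j j = 1.
Proof.
by elim: j => [|j IHj] //=; rewrite IHj !fcoef_gt // !mulr0 add0r addr0.
Qed.

(* The transpose of multiplication by [f] in the basis [e]. *)
Definition fadj (F : nat -> R) (a : nat) : R :=
  (x + y) * F a + F a.+1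
  + (match a with 0 => 0 | 1 => F 0 *+ 2 | a'.+2 => F a'.+1 end) * q.

(** Summation by parts: shifting indices leaves only boundary terms with [fcoef j] in columns m and
    m + 1, which vanish because j < m. *)
Lemma fcoefS_sum (j m : nat) (F : nat -> R) : (j < m)%N ->
  \sum_(a < m.+1) fcoef j.+1 a * F a = \sum_(a < m.+1) fcoef j a * fadj F a.
Proof.
case: m => // m; rewrite ltnS => le_jm.
rewrite (big_ord_recl_nat (fun a => fcoef j.+1 a * F a)).
rewrite (big_ord_recl_nat (fun a => fcoef j a * fadj F a)).
have -> : \sum_(a < m.+1) fcoef j.+1 a.+1 * F a.+1 =
    (x + y) * \sum_(a < m.+1) fcoef j a.+1 * F a.+1
    + \sum_(a < m.+1) fcoef j a * F a.+1
    + q * \sum_(a < m.+1) fcoef j a.+2 * F a.+1.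
  by rewrite !mulr_sumr -!big_split; apply: eq_bigr => a _ /=; ring.
have -> : \sum_(a < m.+1) fcoef j a.+1 * fadj F a.+1 =
    (x + y) * \sum_(a < m.+1) fcoef j a.+1 * F a.+1
    + \sum_(a < m.+1) fcoef j a.+1 * F a.+2
    + q * (fcoef j 1 * F 0 *+ 2 + \sum_(a < m) fcoef j a.+2 * F a.+1).
  rewrite (big_ord_recl_nat (fun a => fcoef j a.+1 * fadj F a.+1)).
  rewrite (big_ord_recl_nat (fun a => fcoef j a.+1 * F a.+1)).
  rewrite (big_ord_recl_nat (fun a => fcoef j a.+1 * F a.+2)).
  rewrite !mulrDr !mulr_sumr.
  have -> : \sum_(a < m) fcoef j a.+2 * fadj F a.+2 =
     \sum_(a < m) (x + y) * (fcoef j a.+2 * F a.+2)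
     + \sum_(a < m) fcoef j a.+2 * F a.+3 + \sum_(a < m) q * (fcoef j a.+2 * F a.+1).
    by rewrite -!big_split; apply: eq_bigr => a _ /=; rewrite /fadj; ring.
  by rewrite /fadj /=; ring.
rewrite (big_ord_recl_nat (fun a => fcoef j a * F a.+1)).
rewrite [\sum_(a < m.+1) fcoef j a.+1 * F a.+2]big_ord_recr.
rewrite [\sum_(a < m.+1) fcoef j a.+2 * F a.+1]big_ord_recr /=.
have -> : fcoef j m.+1 = 0 by rewrite fcoef_gt.
have -> : fcoef j m.+2 = 0 by rewrite fcoef_gt // leqW.
rewrite /fadj /=.
ring.
Qed.

(* The coefficient of [z^d] in [e_a]. *)
Definition ecoef (d : int) (a : nat) : R :=
  (d == a%:Z)%:R + ((0 < a)%N && (d == - a%:Z))%:R * q ^+ a.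

(** Both sides are the coefficient of z^d in f e_a, expanding either f e_a in the basis or f itself.
    The doubled term of [fadj] at a = 1 comes from (z + q / z)^2 = e_2 + 2 q e_0. *)
Lemma fadj_ecoef (d : int) (a : nat) :
  fadj (ecoef d) a = (x + y) * ecoef d a + ecoef (d - 1) a + q * ecoef (d + 1) a.
Proof.
rewrite /fadj -!addrA; congr (_ + _); rewrite /ecoef !subr_eq.
case: a => [|[|a]] /=.
- rewrite mul0r !addr0 !mul0r !addr0 addr_eq0 !expr1 add0r.
  ring.
- have -> : (d + 1 == 1%:Z) = (d == 0%:Z) by lia.
  have -> : (d == 1%:Z + 1) = (d == 2%:Z) by lia.
  have -> : (d == -1%:Z + 1) = (d == 0%:Z) by lia.
  have -> : (d + 1 == -1%:Z) = (d == - 2%:Z) by lia.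
  ring.
have -> : (d + 1 == a.+2%:Z) = (d == a.+1%:Z) by lia.
have -> : (d == a.+2%:Z + 1) = (d == a.+3%:Z) by lia.
have -> : (d == - a.+2%:Z + 1) = (d == - a.+1%:Z) by lia.
have -> : (d + 1 == - a.+2%:Z) = (d == - a.+3%:Z) by lia.
rewrite !exprS; ring.
Qed.

(** By the first-step recursion a path sum is the coefficient of z^(k - l) in f^j. The bound m gives
    all powers a common number of columns. *)
Lemma path_sum_fcoef (j m : nat) (l k : int) : (j <= m)%N ->
  path_sum x y j l k = \sum_(a < m.+1) fcoef j a * ecoef (k - l) a.
Proof.
elim: j l => [|j IHj] l le_jm.
  rewrite path_sum0 big_ord_recl big1 /= => [|a _]; last by rewrite mul0r.
  by rewrite /ecoef mul0r !addr0 mul1r.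
rewrite path_sumS fcoefS_sum // !IHj ?(ltnW le_jm) // !mulr_sumr -!big_split /=.
apply: eq_bigr => a _; rewrite fadj_ecoef.
have -> : k - (l + 1) = k - l - 1 by lia.
have -> : k - (l - 1) = k - l + 1 by lia.
ring.
Qed.

(* The value of [e_a] at [z = - x], a zero of [f]. *)
Definition eval_e (a : nat) : R :=
  if a == 0%N then 1 else (-1) ^+ a * (x ^+ a + y ^+ a).

(** At z = - x one has q / z = - y, hence f = - x + (x + y) - y = 0 and e_a = (- x)^a + (- y)^a for
    a > 0. *)
Lemma fadj_eval_e (a : nat) : fadj eval_e a = 0.
Proof. by case: a => [|[|a]]; rewrite /fadj /eval_e /= ?exprS; ring. Qed.

Lemma fcoef_eval_e (j m : nat) : (j <= m)%N ->
  \sum_(a < m.+1) fcoef j a * eval_e a = (j == 0%N)%:R.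
Proof.
case: j => [_|j le_jm].
  rewrite big_ord_recl big1 /= => [|a _]; last by rewrite mul0r.
  by rewrite addr0 mul1r.
by rewrite fcoefS_sum // big1 // => a _; rewrite fadj_eval_e mulr0.
Qed.

End Coefficients.

(** * Reduction to a sparse bordered matrix *)

Section Bordered.
Variables (R : comNzRingType) (x y t : R) (k : nat).
Local Notation q := (x * y).
Local Notation eval_e := (eval_e x y).

(* The coefficient of [z^k] in [(z^i + t (q / z)^i) e_a]. *)
Definition gcoef (i a : nat) : R :=
  (a == (i - k) + (k - i))%N%:R * q ^+ (i - k) + (a == i + k)%N%:R * (t * q ^+ i).

Definition gmx (m : nat) : 'M[R]_m := \matrix_(i, j) gcoef i j.

Definition bordered (n : nat) : 'M[R]_n.+1 :=
  \matrix_(i, a) if (i < n)%N then gcoef i a else eval_e a.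

(** Multiplying e_a by z^i moves the wanted exponent to k - i; multiplying by (q / z)^i moves it to
    k + i. A negative k - i picks the term q^a z^(- a) of e_a, whence the truncated exponent i - k
    of q. *)
Lemma gcoefE (i a : nat) :
  ecoef x y (k%:Z - i%:Z) a + t * q ^+ i * ecoef x y (k%:Z + i%:Z) a = gcoef i a.
Proof.
rewrite /ecoef /gcoef.
have -> : (k%:Z + i%:Z == a%:Z) = (a == i + k)%N by lia.
have -> : (0 < a)%N && (k%:Z + i%:Z == - a%:Z) = false by lia.
rewrite mul0r addr0 [t * _ * _]mulrC; congr (_ + _).
have [le_ki|lt_ik] := leqP k i.
  have -> : (k%:Z - i%:Z == a%:Z) = ((a == 0) && (a == i - k))%N by lia.
  have -> : (0 < a)%N && (k%:Z - i%:Z == - a%:Z) = ((0 < a) && (a == i - k))%N by lia.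
  have -> : (a == i - k + (k - i))%N = (a == i - k)%N by lia.
  have [->|_] := eqVneq a (i - k)%N; last by rewrite !andbF !mul0r addr0.
  by have [->|_] := posnP (i - k)%N; rewrite /= !(mul0r, mul1r, addr0, add0r).
have -> : (k%:Z - i%:Z == a%:Z) = (a == k - i)%N by lia.
have -> : (0 < a)%N && (k%:Z - i%:Z == - a%:Z) = false by lia.
have -> : (i - k = 0)%N by lia.
by rewrite mul0r addr0 mulr1.
Qed.

(** Column j of the unitriangular [W] holds the coordinates of f^j. Multiplying by [W] turns the
    rows i < n into entries for f^j and the last row into the values f^j(- x), that is (1, 0, ...,
    0). Expanding along it deletes the column of f^0, so column j of the minor belongs to f^(j + 1),
    at the cost of the sign (-1)^n. *)
Lemma det_path_mx (n : nat) :
  \det (path_mx x y t n k%:Z) = (-1) ^+ n * \det (bordered n).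
Proof.
pose W := \matrix_(a < n.+1, j < n.+1) fcoef x y j a.
have detW : \det W = 1.
  rewrite -det_tr det_trig.
    by rewrite big1 // => i _; rewrite !mxE fcoef_diag.
  by apply/is_trig_mxP => i j lt_ij; rewrite !mxE fcoef_gt.
have AW_row (i : 'I_n.+1) (j : 'I_n.+1) : (i < n)%N -> (bordered n *m W) i j =
    path_sum x y j i%:Z k + t * q ^+ i * path_sum x y j (- i%:Z) k.
  move=> lt_in; rewrite !mxE !(path_sum_fcoef _ _ _ _ (ltn_ord j : (j <= n)%N)).
  rewrite mulr_sumr -big_split; apply: eq_bigr => a _.
  rewrite !mxE lt_in -gcoefE opprK /=; ring.
have AW_last j : (bordered n *m W) ord_max j = (j == 0)%:R.
  rewrite mxE -(@fcoef_eval_e _ x y j n (ltn_ord j)); apply: eq_bigr => a _.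
  by rewrite !mxE ltnn mulrC.
have -> : \det (bordered n) = \det (bordered n *m W).
  by rewrite det_mulmx detW mulr1.
rewrite (expand_det_row _ ord_max).
rewrite big_ord_recl big1 => [|j _]; last by rewrite AW_last mul0r.
rewrite AW_last eqxx mul1r addr0 /cofactor /= addn0 signrMK.
congr (\det _); apply/matrixP => i j.
have i_lt : (lift ord_max i < n)%N by rewrite lift_max.
by rewrite [RHS]mxE [RHS]mxE AW_row // mxE lift_max lift0.
Qed.

(** Multiply [A *m u] on the left by the adjugate and read entry [c]: Cramer's rule without
    division. *)
Lemma det_kernel (m : nat) (A : 'M[R]_m.+1) (u : 'cV[R]_m.+1) (l : R) (c : 'I_m.+1) :
  (forall i, (A *m u) i 0 = (i == ord_max)%:R * l) ->
  \det A * u c 0 = l * cofactor A ord_max c.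
Proof.
move=> Au; have := congr1 (fun B => (B *m u) c 0) (mul_adj_mx A).
rewrite mul_scalar_mx -mulmxA !mxE => <-.
rewrite (bigD1 ord_max) //= Au eqxx mul1r big1 => [|i /negPf ne_i].
  by rewrite addr0 mxE mulrC.
by rewrite Au ne_i mul0r mulr0.
Qed.

(** Cofactors along the last row do not see that row, so it may be replaced by the row n of
    [gcoef]. *)
Lemma cofactor_bordered (n : nat) (c : 'I_n.+1) :
  cofactor (bordered n) ord_max c = cofactor (gmx n.+1) ord_max c.
Proof.
congr (_ * \det _); apply/matrixP => i j.
by rewrite !mxE lift_max ltn_ord.
Qed.

Lemma cofactor_gmx_last (n : nat) : cofactor (gmx n.+1) ord_max ord_max = \det (gmx n).
Proof.
rewrite /cofactor -signr_odd addnn odd_double mul1r.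
by congr (\det _); apply/matrixP => i j; rewrite !mxE !lift_max.
Qed.

(** In row n the column n + k falls outside the matrix, so expansion along this row keeps only the
    entry q^c in column c = n - k. *)
Lemma cofactor_gmx (n : nat) (c : 'I_n.+1) : (0 < k)%N -> (k + c = n)%N ->
  q ^+ c * cofactor (gmx n.+1) ord_max c = \det (gmx n.+1).
Proof.
move=> k_gt0 def_n; rewrite (expand_det_row _ ord_max) (bigD1 c) //= big1.
  rewrite addr0 mxE /gcoef /=.
  have -> : (c == n - k + (k - n) :> nat)%N by lia.
  have -> : (c == n + k :> nat)%N = false by lia.
  have -> : (n - k = c)%N by lia.
  by rewrite mul0r mul1r addr0.
move=> a ne_ac; rewrite mxE /gcoef /=.
have /negPf neq : (a != c :> nat) by [].
have a_lt := ltn_ord a.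
have -> : (a == n - k + (k - n) :> nat)%N = false by lia.
have -> : (a == n + k :> nat)%N = false by lia.
by rewrite !mul0r addr0 mul0r.
Qed.

Lemma sum_gcoef (m : nat) (i : nat) (u : nat -> R) :
  (forall a, (m <= a)%N -> u a = 0) ->
  \sum_(a < m) gcoef i a * u a =
  q ^+ (i - k) * u ((i - k) + (k - i))%N + t * q ^+ i * u (i + k)%N.
Proof.
move=> u0.
have pick (b : nat) c : \sum_(a < m) (a == b :> nat)%:R * c * u a = c * u b.
  have [lt_bm|le_mb] := ltnP b m.
    rewrite (bigD1 (Ordinal lt_bm)) //= eqxx mul1r big1 ?addr0 // => a.
    by rewrite -(inj_eq val_inj) /= => /negPf->; rewrite !mul0r.
  rewrite u0 // mulr0 big1 // => a _.
  have a_lt := ltn_ord a.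
  have -> : (a == b :> nat) = false by lia.
  by rewrite !mul0r.
by rewrite /gcoef; under eq_bigr do rewrite mulrDl; rewrite big_split /= !pick.
Qed.

Lemma det_bordered_kernel (n : nat) (u : nat -> R) (c : 'I_n.+1) :
  (forall a, (n < a)%N -> u a = 0) ->
  (forall i, (i < n)%N ->
    q ^+ (i - k) * u ((i - k) + (k - i))%N + t * q ^+ i * u (i + k)%N = 0) ->
  \det (bordered n) * u c =
  (\sum_(a < n.+1) eval_e a * u a) * cofactor (gmx n.+1) ord_max c.
Proof.
move=> u0 ker_u; rewrite -cofactor_bordered.
rewrite -(@det_kernel _ _ (\col_a u a)) ?mxE // => i; rewrite mxE.
under eq_bigr do rewrite !mxE.
have [->|ne_i] := eqVneq i ord_max; first by rewrite ltnn mul1r.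
have lt_in : (i < n)%N.
  have := ltn_ord i; rewrite ltnS leq_eqVlt => /orP[/eqP i_n|//].
  by case/eqP: ne_i; apply: val_inj.
by rewrite lt_in sum_gcoef // ker_u // mul0r.
Qed.

End Bordered.

(** * Determinants of block and antidiagonal matrices *)

Section Determinants.
Variable R : comNzRingType.

Lemma det_block_swap (k : nat) :
  \det (block_mx 0 1%:M 1%:M 0 : 'M[R]_(k + k)) = (-1) ^+ k.
Proof.
(* Two unipotent factors surround a triangular one with diagonal blocks -1 and 1, which carries the
   sign. *)
have -> : block_mx 0 1%:M 1%:M 0 = block_mx 1%:M 1%:M 0 1%:M
    *m block_mx (- 1%:M) 0 1%:M 1%:M *m block_mx 1%:M (- 1%:M) 0 1%:M :> 'M[R]_(k + k).
  rewrite !mulmx_block !(mulmx1, mul1mx, mulmx0, mul0mx, addr0, add0r).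
  by rewrite addNr mul0mx add0r.
rewrite !det_mulmx !det_ublock det_lblock !det1 !mulr1 mul1r.
by rewrite -scaleN1r detZ det1 mulr1.
Qed.

(** In a factorization into block triangular matrices, [U], [V] and [W] occur only off the diagonal
    blocks and so drop out. *)
Lemma det_block_antidiag (m k : nat) (G : 'M[R]_m) (U : 'M_(m, k)) (V : 'M_(k, m))
    (W B C : 'M_k) :
  \det (block_mx G (row_mx U 0) (col_mx V 0) (block_mx W B C 0)) =
  (-1) ^+ k * \det B * \det C * \det G.
Proof.
have -> : block_mx G (row_mx U 0) (col_mx V 0) (block_mx W B C 0) =
    block_mx 1%:M (row_mx 0 U) 0 (block_mx 1%:M W 0 C)
    *m block_mx G 0 (col_mx V 0) (block_mx 0 B 1%:M 0).
  rewrite !mulmx_block mul_row_col mul_row_block mul_block_col.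
  by rewrite !(mul1mx, mulmx1, mulmx0, mul0mx, addr0, add0r).
have -> : block_mx 0 B 1%:M 0 = block_mx B 0 0 1%:M *m block_mx 0 1%:M 1%:M 0 :> 'M_(k + k).
  by rewrite mulmx_block !(mul1mx, mulmx1, mulmx0, mul0mx, addr0, add0r).
rewrite det_mulmx det_ublock det_lblock det_mulmx !det_ublock det_block_swap !det1.
ring.
Qed.

Lemma det_antidiag (m : nat) (c : nat -> R) :
  \det (\matrix_(i < m, j < m) (((i + j).+1 == m)%N%:R * c i)) =
  (-1) ^+ 'C(m, 2) * \prod_(i < m) c i.
Proof.
elim: m c => [|m IHm] c; first by rewrite det_mx00 big_ord0 mul1r.
rewrite (expand_det_row _ ord0) (bigD1 ord_max) //= big1 => [|j ne_j].
  rewrite addr0 mxE eqxx mul1r /cofactor.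
  rewrite [\det _](_ : _ = \det (\matrix_(i < m, j < m) (((i + j).+1 == m)%N%:R * c i.+1))).
    rewrite (IHm (fun i => c i.+1)) big_ord_recl binS bin1 !exprD /=.
    rewrite [in RHS](eq_bigr (fun i : 'I_m => c i.+1)) //; ring.
  by congr (\det _); apply/matrixP => i j; rewrite !mxE lift0 lift_max addSn eqSS.
rewrite mxE add0n eqSS; have -> : (j == m :> nat) = false.
  by apply: contraNF ne_j => /eqP j_m; apply/eqP/val_inj.
by rewrite !mul0r.
Qed.

End Determinants.

(** * Determinants of the sparse matrix [gmx] *)

Section GDet.
Variables (R : comNzRingType) (x y t : R) (k : nat).
Local Notation q := (x * y).
Local Notation g := (gcoef x y t k).
Local Notation G := (gmx x y t k).

Lemma gcoef0 (i a : nat) : (a != (i - k) + (k - i))%N -> (a != i + k)%N -> g i a = 0.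
Proof. by rewrite /gcoef => /negPf-> /negPf->; rewrite !mul0r addr0. Qed.

(** Among the last k columns, column m + k + i is met only by row m + i, and row m + k + i meets
    only column m + i; hence the diagonal blocks [B] and [C]. The extra 1 in [B] for m + i = 0
    arises because both entries of row 0 fall in column k. *)
Lemma det_gmx_step (m : nat) : (0 < k)%N ->
  \det (G (m + (k + k))) =
  (-1) ^+ k * \prod_(i < k) (((m + i == 0)%N%:R + t * q ^+ (m + i)) * q ^+ (m + i))
  * \det (G m).
Proof.
move=> k_gt0.
pose U := \matrix_(i < m, j < k) g i (m + j).
pose V := \matrix_(i < k, j < m) g (m + i) j.
pose W := \matrix_(i < k, j < k) g (m + i) (m + j).
pose B := diag_mx (\row_(i < k) ((m + i == 0)%N%:R + t * q ^+ (m + i))).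
pose C := diag_mx (\row_(i < k) q ^+ (m + i)).
have -> : G (m + (k + k)) = block_mx (G m) (row_mx U 0) (col_mx V 0) (block_mx W B C 0).
  apply/matrixP => i j; rewrite mxE.
  case: (split_ordP i) => [{}i ->|{}i ->]; case: (split_ordP j) => [{}j ->|{}j ->] /=.
  - by rewrite block_mxEul mxE.
  - rewrite block_mxEur; case: (split_ordP j) => [{}j ->|{}j ->] /=.
      by rewrite row_mxEl mxE.
    have i_lt := ltn_ord i; rewrite row_mxEr mxE gcoef0 //; lia.
  - rewrite block_mxEdl; case: (split_ordP i) => [{}i ->|{}i ->] /=.
      by rewrite col_mxEu mxE.
    have j_lt := ltn_ord j; rewrite col_mxEd mxE gcoef0 //; lia.
  rewrite block_mxEdr; case: (split_ordP i) => [{}i ->|{}i ->];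
    case: (split_ordP j) => [{}j ->|{}j ->] /=.
  - by rewrite block_mxEul mxE.
  - have i_lt := ltn_ord i; have j_lt := ltn_ord j.
    rewrite block_mxEur !mxE /gcoef.
    have -> : (m + (k + j) == m + i + k)%N = (i == j) by rewrite -[i == j]val_eqE /=; lia.
    have -> : (m + (k + j) == m + i - k + (k - (m + i)))%N = (i == j) && (m + i == 0)%N.
      by rewrite -[i == j]val_eqE /=; lia.
    have [_|] := eqVneq i j; rewrite /= ?mul0r ?addr0 // mul1r mulr1n.
    have [mi0|_] := eqVneq; last by rewrite mul0r.
    by rewrite mi0 sub0n expr0 mul1r.
  - have i_lt := ltn_ord i; have j_lt := ltn_ord j.
    rewrite block_mxEdl !mxE /gcoef.
    have -> : (m + j == m + (k + i) + k)%N = false by lia.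
    have -> : (m + j == m + (k + i) - k + (k - (m + (k + i))))%N = (i == j).
      by rewrite -[i == j]val_eqE /=; lia.
    have -> : (m + (k + i) - k = m + i)%N by lia.
    by case: eqP; rewrite /= ?mul0r ?mul1r ?addr0.
  have i_lt := ltn_ord i; have j_lt := ltn_ord j; rewrite block_mxEdr !mxE gcoef0 //; lia.
rewrite det_block_antidiag !det_diag -!mulrA mulrA [in RHS]big_split /= -!mulrA.
by congr (_ * (_ * (_ * _))); apply: eq_bigr => i _; rewrite mxE.
Qed.

Lemma prod_step (j m : nat) :
  \prod_(i < j) ((t * q ^+ (m.+1 + i)) * q ^+ (m.+1 + i)) =
  t ^+ j * q ^+ (j * (2 * m + j + 1)).
Proof.
elim: j => [|j IHj]; first by rewrite big_ord0 mulr1.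
rewrite big_ord_recr /= IHj [t ^+ j.+1]exprSr.
have -> : (j.+1 * (2 * m + j.+1 + 1) = j * (2 * m + j + 1) + (m.+1 + j) + (m.+1 + j))%N.
  by lia.
rewrite !exprD; ring.
Qed.

(** The peeling ends at the empty matrix. The factor 1 + t comes from row 0, hence only from the
    step with m = 0; every other step contributes a product as in [prod_step]. *)
Lemma det_gmx_even (N : nat) : (0 < k)%N ->
  \det (G (2 * k * N.+1)) = (-1) ^+ (k * N.+1) * (1 + t) * t ^+ (k * N.+1 - 1)
    * q ^+ (k * N.+1 * (2 * k * N.+1 - k - 1)).
Proof.
move=> k_gt0; elim: N => [|N IHN].
  rewrite !muln1 (_ : 2 * k = 0 + (k + k))%N; last by lia.
  rewrite det_gmx_step // det_mx00 mulr1 -!mulrA; congr (_ * _).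
  case: k k_gt0 => // j _; rewrite big_ord_recl /= !expr0 !mulr1; congr (_ * _).
  rewrite (eq_bigr (fun i : 'I_j => t * q ^+ (1 + i) * q ^+ (1 + i))) => [|i _].
    rewrite prod_step subSS subn0; congr (_ * _ ^+ _); nia.
  by rewrite add0r.
rewrite (_ : 2 * k * N.+2 = 2 * k * N.+1 + (k + k))%N; last by ring.
rewrite det_gmx_step // IHN.
rewrite [\prod_(_ < _) _](_ : _ = t ^+ k * q ^+ (k * (2 * (2 * k * N.+1).-1 + k + 1))).
  have -> : (k * N.+2 = k + k * N.+1)%N by ring.
  have -> : (k + k * N.+1 - 1 = k + (k * N.+1 - 1))%N by nia.
  have -> : ((k + k * N.+1) * (2 * k * N.+1 + (k + k) - k - 1) =
      k * (2 * (2 * k * N.+1).-1 + k + 1) + k * N.+1 * (2 * k * N.+1 - k - 1))%N.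
    nia.
  rewrite !exprD; ring.
rewrite -prod_step; apply: eq_bigr => i _.
rewrite prednK ?muln_gt0 ?k_gt0 // addn_eq0 muln_eq0 /= muln_eq0.
by rewrite -[k == 0%N]negbK -lt0n k_gt0 add0r.
Qed.

Lemma det_gmx_odd (N : nat) : (0 < k)%N ->
  \det (G (k + 1 + 2 * k * N)) = (-1) ^+ ('C(k + 1, 2) + k * N) * (1 + t) * t ^+ (k * N)
    * q ^+ (k * N * (2 * k * N + k + 1)).
Proof.
move=> k_gt0; elim: N => [|N IHN].
  rewrite !muln0 !addn0 !mul0n !mulr1 addn1.
  (* In order k + 1, row i keeps its column k - i alone: column k + i fits only for i = 0, where the
     two coincide and add up to 1 + t. *)
  rewrite (_ : G k.+1 = \matrix_(i < k.+1, j < k.+1) (((i + j).+1 == k.+1)%N%:R *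
     (if i == 0 :> nat then 1 + t else 1))).
    rewrite (det_antidiag _ (fun i => if i == 0%N then 1 + t else 1)); congr (_ * _).
    by rewrite big_ord_recl /= big1 ?mulr1.
  apply/matrixP => i j; rewrite !mxE /gcoef.
  have i_lt := ltn_ord i; have j_lt := ltn_ord j.
  have -> : (i - k = 0)%N by lia.
  have -> : (j == 0 + (k - i) :> nat)%N = ((i + j).+1 == k.+1)%N by lia.
  have -> : (j == i + k :> nat)%N = ((i + j).+1 == k.+1)%N && (i == 0%N :> nat) by lia.
  by case: eqP; case: eqP => [->|_]; rewrite /= !(mul0r, mul1r, addr0, expr0, mulr1).
rewrite (_ : k + 1 + 2 * k * N.+1 = k + 1 + 2 * k * N + (k + k))%N; last by ring.
rewrite det_gmx_step // IHN.
rewrite [\prod_(_ < _) _](_ : _ = t ^+ k * q ^+ (k * (2 * (k + 2 * k * N) + k + 1))).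
  have -> : (k * N.+1 * (2 * k * N.+1 + k + 1) =
      k * (2 * (k + 2 * k * N) + k + 1) + k * N * (2 * k * N + k + 1))%N by ring.
  have -> : (k * N.+1 = k + k * N)%N by ring.
  rewrite !exprD; ring.
rewrite -prod_step; apply: eq_bigr => i _.
by rewrite addn1 addSn /= add0r addSn.
Qed.

End GDet.

(** * Kernel vectors and the polynomials P_{m,k} *)

Section Kernels.
Variables (R : comNzRingType) (x y t : R) (k : nat).
Local Notation q := (x * y).
Local Notation eval_e := (eval_e x y).
Local Notation P m := (Ppol m k x y t).

(* Solves [u_a = - t q^k u_(a + 2 k)] downwards from [u_(r + 2 k N) = 1]. *)
Definition chain (r N a : nat) : R :=
  \sum_(s < N.+1) (- (t * q ^+ k)) ^+ s * (a == r + 2 * k * (N - s))%N%:R.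

Lemma chain_ratioX (s : nat) :
  (- (t * q ^+ k)) ^+ s = (-1) ^+ s * t ^+ s * (x ^+ (s * k) * y ^+ (s * k)).
Proof. by rewrite -(mulN1r (t * _)) !exprMn -exprM -exprM [(k * s)%N]mulnC mulrA. Qed.

Lemma chainS (r N a : nat) :
  chain r N.+1 a = (a == r + 2 * k * N.+1)%N%:R - t * q ^+ k * chain r N a.
Proof.
rewrite /chain (big_ord_recl_nat (fun s => _ ^+ s * (a == r + 2 * k * (N.+1 - s))%N%:R)).
rewrite mul1r mulr_sumr -sumrN; congr (_ + _).
by apply: eq_bigr => s _; rewrite exprS subSS mulNr mulNr mulrA.
Qed.

Lemma chain_base (r a : nat) : chain r 0 a = (a == r)%:R.
Proof. by rewrite /chain big_ord_recl big_ord0 /= muln0 addn0 mul1r addr0. Qed.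

Lemma chain_gt (r N a : nat) : (r + 2 * k * N < a)%N -> chain r N a = 0.
Proof.
move=> lt_a; rewrite /chain big1 // => s _.
have le : (2 * k * (N - s) <= 2 * k * N)%N by rewrite leq_mul2l leq_subr orbT.
have -> : (a == r + 2 * k * (N - s))%N = false by lia.
by rewrite mulr0.
Qed.

(** Entries 2k apart have ratio - t q^k, so everything cancels except at the top; r < 2k rules out a
    + 2k = r. *)
Lemma chain_rec (r N a : nat) : (r < 2 * k)%N ->
  chain r N a + t * q ^+ k * chain r N (a + 2 * k) = (a == r + 2 * k * N)%N%:R.
Proof.
move=> lt_r; elim: N => [|N IHN].
  rewrite !chain_base; have -> : (a + 2 * k == r)%N = false by lia.
  by rewrite mulr0 addr0 muln0 addn0.
rewrite !chainS mulrBr; set c := t * q ^+ k in IHN *.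
have -> : (a + 2 * k == r + 2 * k * N.+1)%N = (a == r + 2 * k * N)%N.
  by rewrite mulnS; lia.
rewrite -IHN; ring.
Qed.

Lemma chain_top (r N : nat) : (0 < k)%N -> chain r N (r + 2 * k * N) = 1.
Proof.
move=> k_gt0; case: N => [|N]; first by rewrite muln0 addn0 chain_base eqxx.
rewrite chainS eqxx chain_gt ?mulr0 ?subr0 //.
by rewrite ltn_add2l ltn_mul2l muln_gt0 k_gt0 /=.
Qed.

Lemma chain_low (r N a : nat) : (r < 2 * k)%N -> (a < 2 * k)%N ->
  chain r N a = (- (t * q ^+ k)) ^+ N * (a == r)%:R.
Proof.
move=> lt_r lt_a; elim: N => [|N IHN]; first by rewrite chain_base mul1r.
rewrite chainS IHN exprS; have -> : (a == r + 2 * k * N.+1)%N = false.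
  by rewrite mulnS; lia.
by rewrite sub0r -!mulNr !mulrA.
Qed.

Lemma sum_chain (r N n : nat) (F : nat -> R) : (r + 2 * k * N <= n)%N ->
  \sum_(a < n.+1) F a * chain r N a =
  \sum_(s < N.+1) (- (t * q ^+ k)) ^+ s * F (r + 2 * k * (N - s))%N.
Proof.
move=> le_n; under eq_bigr do rewrite mulr_sumr.
rewrite exchange_big; apply: eq_bigr => s _.
have lt_n : (r + 2 * k * (N - s) < n.+1)%N.
  by rewrite ltnS (leq_trans _ le_n) // leq_add2l leq_mul2l leq_subr orbT.
rewrite (bigD1 (Ordinal lt_n)) //= eqxx mulr1 mulrC big1 ?addr0 // => a.
by rewrite -val_eqE /= => /negPf->; rewrite !mulr0.
Qed.

(** For i >= k the columns i - k and i + k differ by 2k and [chain_rec] kills the row, the bound on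
    i keeping i - k below the top. For i < k both columns k - i and k + i are below 2k, where the
    chain has only its lowest entry, at r. *)
Lemma chain_row (r N i : nat) : (r < 2 * k)%N -> (i < r + 2 * k * N + k)%N ->
  q ^+ (i - k) * chain r N (i - k + (k - i)) + t * q ^+ i * chain r N (i + k) =
  (- (t * q ^+ k)) ^+ N * ((i < k)%N && (i + r == k)%N)%:R
  + t * q ^+ i * (- (t * q ^+ k)) ^+ N * ((i < k)%N && (i + k == r)%N)%:R.
Proof.
move=> lt_r lt_i; have [lt_ik|le_ki] := ltnP i k.
  rewrite !chain_low //; try lia.
  have -> : (i - k = 0)%N by lia.
  have -> : (0 + (k - i) == r)%N = (i + r == k)%N by lia.
  by rewrite mul1r !mulrA.
have -> : (i - k + (k - i) = i - k)%N by lia.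
have -> : (i + k = i - k + 2 * k)%N by lia.
have e : q ^+ i = q ^+ (i - k) * q ^+ k by rewrite -exprD subnK.
rewrite /= !mulr0 addr0 e -[t * _]mulrCA -mulrA -mulrDr chain_rec //.
have -> : (i - k == r + 2 * k * N)%N = false by lia.
by rewrite mulr0.
Qed.

Lemma fold_sum_even (N : nat) (F : nat -> R) :
  \sum_(0 <= s < N + N) F s = \sum_(s < N) (F s + F (N + N - s.+1)%N).
Proof.
rewrite big_mkord big_split_ord big_split /=; congr (_ + _).
rewrite (reindex_inj rev_ord_inj); apply: eq_bigr => s _ /=.
by congr F; have := ltn_ord s; lia.
Qed.

Lemma fold_sum_odd (N : nat) (F : nat -> R) :
  \sum_(0 <= s < (N + N).+1) F s = \sum_(s < N) (F s + F (N + N - s)%N) + F N.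
Proof.
rewrite -addnS big_mkord big_split_ord big_split /= -addrA; congr (_ + _).
rewrite (reindex_inj rev_ord_inj) big_ord_recr /= subnn addn0; congr (_ + _).
by apply: eq_bigr => s _ /=; congr F; have := ltn_ord s; lia.
Qed.

(** Entry s of the chain, in column 2k(N - s), yields the terms s and 2N - s of P. For s = N they
    merge into the middle term, in agreement with e_0 = 1. *)
Lemma sum_eval_chain0 (N n : nat) : (0 < k)%N -> (2 * k * N <= n)%N ->
  \sum_(a < n.+1) eval_e a * chain 0 N a = P (2 * k * N).
Proof.
move=> k_gt0 le_n; rewrite sum_chain // /Ppol.
have -> : (k %| 2 * k * N)%N by rewrite mulnAC dvdn_mull.
have -> : (2 * k * N %/ k = N + N)%N by rewrite mulnAC mulnK // mul2n addnn.
rewrite fold_sum_odd big_ord_recr /=; congr (_ + _).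
  apply: eq_bigr => s _; have lt_sN := ltn_ord s.
  rewrite /eval_e add0n.
  have -> : (2 * k * (N - s) == 0)%N = false by nia.
  have -> : minn s (N + N - s) = s by lia.
  have -> : minn (N + N - s) (N + N - (N + N - s)) = s by lia.
  have -> : (2 * k * N - s * k = s * k + 2 * k * (N - s))%N by nia.
  have -> : ((N + N - s) * k = s * k + 2 * k * (N - s))%N by nia.
  have -> : (2 * k * N - (s * k + 2 * k * (N - s)) = s * k)%N by nia.
  have -> : (-1 : R) ^+ (2 * k * (N - s)) = 1.
    by rewrite -signr_odd -mulnA oddM.
  have -> : (-1 : R) ^+ (N + N - s) = (-1) ^+ s.
    by rewrite (_ : N + N - s = s + (N - s) * 2)%N ?exprD ?exprM ?sqrr_sign ?mulr1 //; lia.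
  rewrite chain_ratioX !exprD; ring.
have -> : minn N (N + N - N) = N by lia.
have -> : (2 * k * N - N * k = N * k)%N by nia.
by rewrite subnn muln0 /= /eval_e /= mulr1 chain_ratioX mulrA.
Qed.

(** Here P has 2N + 2 summands. Entry s of the chain from k + 1 yields summand s; entry s of the
    chain from k - 1, thanks to the weight - t q, yields summand 2N + 1 - s. All columns involved
    have the parity of k + 1, whence the global sign. *)
Lemma sum_eval_chain1 (N n : nat) : (1 < k)%N -> (k + 1 + 2 * k * N <= n)%N ->
  \sum_(a < n.+1) eval_e a * (chain (k + 1) N a - t * q * chain (k - 1) N a) =
  (-1) ^+ (k + 1) * P (k + 1 + 2 * k * N).
Proof.
move=> k_gt1 le_n; set m := (_ + 2 * k * N)%N; have k_gt0 := ltnW k_gt1.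
under eq_bigr do rewrite mulrBr mulrCA.
rewrite big_split /= sumrN -mulr_sumr !sum_chain //; last by lia.
have def_m : (m = (N + N).+1 * k + 1)%N by rewrite /m; lia.
rewrite /Ppol.
have -> : (k %| m)%N = false.
  by rewrite def_m dvdn_addr ?dvdn_mull // dvdn1; lia.
have -> : (m %/ k = (N + N).+1)%N.
  by rewrite def_m divnMDl // divn_small ?addn0.
have -> : ceil_div m k = (N + N).+2.
  rewrite /ceil_div (_ : m + k.-1 = (N + N).+2 * k)%N ?mulnK //; lia.
rewrite (_ : (N + N).+2 = N.+1 + N.+1)%N ?fold_sum_even; last by lia.
rewrite [t * q * _]mulr_sumr -sumrB mulr_sumr; apply: eq_bigr => s _; have lt_sN := ltn_ord s.
have -> : (N.+1 + N.+1 - s.+1 = (N + N).+1 - s)%N by lia.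
have -> : minn s (N.+1 + N.+1 - s) = s by lia.
have -> : minn ((N + N).+1 - s) (N.+1 + N.+1 - ((N + N).+1 - s)) = s.+1 by lia.
set c1 := (k + 1 + 2 * k * (N - s))%N; set c2 := (k - 1 + 2 * k * (N - s))%N.
have c1_neq0 : (c1 == 0)%N = false by rewrite /c1 addn1.
have c2_neq0 : (c2 == 0)%N = false by rewrite /c2 addn_eq0 subn_eq0 leqNgt k_gt1.
rewrite /eval_e c1_neq0 c2_neq0.
have -> : (m - s * k = s * k + c1)%N by rewrite /m /c1; nia.
have -> : (((N + N).+1 - s) * k = s * k + 1 + c2)%N by rewrite /c2; nia.
have -> : (m - (s * k + 1 + c2) = s * k + 1)%N by rewrite /m /c2; nia.
have -> : (-1 : R) ^+ c1 = (-1) ^+ (k + 1).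
  by rewrite /c1 exprD -mulnA exprM sqrrN expr1n expr1n mulr1.
have -> : (-1 : R) ^+ c2 = (-1) ^+ (k + 1).
  rewrite /c2 !exprD -mulnA exprM sqrrN expr1n expr1n mulr1.
  by rewrite -[in RHS](subnK k_gt0) exprD -mulrA -expr2 sqrr_sign mulr1.
have -> : (-1 : R) ^+ ((N + N).+1 - s) = - (-1) ^+ s.
  rewrite (_ : (N + N).+1 - s = s.+1 + (N - s) * 2)%N; last by lia.
  by rewrite exprD exprM sqrr_sign mulr1 exprS mulN1r.
rewrite chain_ratioX [t ^+ s.+1]exprS; clearbody c1 c2.
move: ((-1) ^+ s) ((-1) ^+ (k + 1)) => e e2; rewrite !exprD; ring.
Qed.

End Kernels.

(** * Vanishing by counting rows and columns of a chain *)

Section Vanishing.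
Variables (R : comNzRingType) (x y t : R) (k : nat).
Local Notation bmx := (bordered x y t k).

Lemma dvdn_addK (d m : nat) : (d %| m + d)%N = (d %| m)%N.
Proof. by rewrite dvdn_addl ?dvdnn. Qed.

(** Every permutation sends some element of [S] outside [T], so each term of the Leibniz expansion
    has a zero factor. *)
Lemma det_hall (m : nat) (A : 'M[R]_m) (S T : {set 'I_m}) : (#|T| < #|S|)%N ->
  (forall i j, i \in S -> j \notin T -> A i j = 0) -> \det A = 0.
Proof.
move=> lt_TS A0; rewrite /determinant big1 // => s _.
have [i Si Tsi] : exists2 i, i \in S & s i \notin T.
  apply/exists_inP; apply: contraLR lt_TS => /exists_inPn sT.
  rewrite -leqNgt -(card_imset _ (@perm_inj _ s)); apply/subset_leq_card/subsetP.
  by move=> _ /imsetP[i Si ->]; rewrite -[_ \in T]negbK sT.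
by rewrite (bigD1 i) //= A0 // mul0r mulr0.
Qed.

Lemma ltn_card_inj (I : finType) (S T : {set I}) (f : I -> I) (b : I) :
  {in T &, injective f} -> {in T, forall a, f a \in S :\ b} -> b \in S ->
  (#|T| < #|S|)%N.
Proof.
move=> f_inj f_sub Sb; rewrite (cardsD1 b S) Sb ltnS -(card_in_imset f_inj).
by apply/subset_leq_card/subsetP => _ /imsetP[a Ta ->]; exact: f_sub.
Qed.

(* The rows in [p] only meet columns in [r], and [f] injects these columns into
   the rows in [p] other than [b]. *)
Lemma det_bordered_hall (n : nat) (p r : pred nat) (f : nat -> nat) (b : nat) :
  (forall i, p i -> r (i - k + (k - i))%N /\ r (i + k)%N) ->
  (forall a, (a <= n)%N -> r a -> (f a < n)%N && p (f a) && (f a != b)) ->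
  (forall a a', (a <= n)%N -> (a' <= n)%N -> r a -> r a' -> f a = f a' -> a = a') ->
  (b < n)%N -> p b ->
  \det (bmx n) = 0.
Proof.
move=> p_r f_p f_inj lt_bn pb.
pose S := [set i : 'I_n.+1 | (i < n)%N && p i]; pose T := [set a : 'I_n.+1 | r a].
have fK (a : 'I_n.+1) : a \in T -> (inord (f a) : 'I_n.+1) = f a :> nat.
  by rewrite inE => /(f_p _ (ltn_ord a))/andP[/andP[lt_fa _] _]; rewrite inordK // ltnW.
have lt_bn1 : (b < n.+1)%N by exact: ltnW.
apply: (@det_hall _ _ S T).
  apply: (@ltn_card_inj _ S T (fun a => inord (f a)) (inord b)).
  - move=> a a' Ta Ta' /(congr1 val); rewrite /= !fK // => eq_f; apply: val_inj.
    by move: Ta Ta'; rewrite !inE => Ta Ta'; apply: f_inj eq_f => //; rewrite -ltnS.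
  - move=> a Ta; rewrite !inE -val_eqE /= fK // inordK //.
    by move: Ta; rewrite inE => /(f_p _ (ltn_ord a))/andP[-> ->].
  - by rewrite inE inordK // lt_bn.
move=> i a; rewrite !inE => /andP[lt_in p_i] r'a; rewrite mxE lt_in gcoef0 //.
  by apply: contraNneq r'a => ->; case: (p_r _ p_i).
by apply: contraNneq r'a => ->; case: (p_r _ p_i).
Qed.

(** The Q + 1 rows 0, 2k, ..., 2kQ meet only columns congruent to k modulo 2k, of which just Q are
    at most n since r < k. The shift by k misses row 2kQ. *)
Lemma det_bordered_low (n Q r : nat) : (0 < r < k)%N -> (n = 2 * k * Q + r)%N ->
  \det (bmx n) = 0.
Proof.
move=> /andP[r_gt0 lt_rk] def_n.
apply: (@det_bordered_hall n (fun i => 2 * k %| i)%N (fun a => 2 * k %| a + k)%N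
  (fun a => a - k)%N (2 * k * Q)).
- move=> i d_i; split; last by rewrite (_ : i + k + k = i + 2 * k)%N ?dvdn_addK //; lia.
  have [le_ki|lt_ik] := leqP k i.
    by rewrite (_ : i - k + (k - i) + k = i)%N //; lia.
  have i0 : i = 0%N by case: (posnP i) => // i_gt0; have := dvdn_leq i_gt0 d_i; lia.
  by rewrite i0 (_ : 0 - k + (k - 0) + k = 2 * k)%N //; lia.
- move=> a le_an d_a; have le_ka : (k <= a)%N by have := dvdn_leq _ d_a; lia.
  apply/andP; split; [apply/andP; split|]; try lia.
  by move: d_a; rewrite (_ : a + k = a - k + 2 * k)%N ?dvdn_addK //; lia.
- move=> a a' _ _ d_a d_a'.
  have le_a b : (2 * k %| b + k)%N -> (2 * k <= b + k)%N by apply: dvdn_leq; lia.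
  by move: (le_a _ d_a) (le_a _ d_a') => {d_a d_a' le_a}; lia.
- lia.
- exact: dvdn_mulr.
Qed.

(** Rows congruent to k - 1 or k + 1 modulo 2k meet only columns congruent to 1 or -1: there are 2Q
    + 2 such rows below n but 2Q + 1 such columns. Columns are shifted by k, except column 1, the
    only one below k, which goes to row 2kQ + k - 1; row 2kQ + k + 1 stays free. *)
Lemma det_bordered_high (n Q r : nat) : (k + 2 <= r)%N -> (r + 2 <= 2 * k)%N ->
  (n = 2 * k * Q + r)%N -> \det (bmx n) = 0.
Proof.
move=> le_kr le_rk def_n; have k_gt1 : (1 < k)%N by lia.
have small (a : nat) : (2 * k %| a + 1)%N || (2 * k %| a + (2 * k - 1))%N ->
    (a < k)%N -> a = 1%N.
  move=> d_a lt_ak; case/orP: d_a => [d_a|]; first by have := dvdn_leq _ d_a; lia.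
  case: a lt_ak => [|a] lt_ak; first by move=> d_a; have := dvdn_leq _ d_a; lia.
  rewrite (_ : a.+1 + (2 * k - 1) = a + 2 * k)%N ?dvdn_addK //; last by lia.
  by case: (posnP a) => [->//|a_gt0] d_a; have := dvdn_leq a_gt0 d_a; lia.
apply: (@det_bordered_hall n (fun i => (2 * k %| i + (k + 1)) || (2 * k %| i + (k - 1)))%N
  (fun a => (2 * k %| a + 1) || (2 * k %| a + (2 * k - 1)))%N
  (fun a => if a < k then 2 * k * Q + (k - 1) else a - k)%N (2 * k * Q + (k + 1))).
- move=> i d_i; split.
    have [le_ki|lt_ik] := leqP k i.
      apply/orP; case/orP: d_i => d_i; [left|right].
        move: d_i; rewrite (_ : i + (k + 1) = i - k + (k - i) + 1 + 2 * k)%N ?dvdn_addK //.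
        lia.
      by rewrite (_ : i - k + (k - i) + (2 * k - 1) = i + (k - 1))%N //; lia.
    apply/orP; right; case/orP: d_i => d_i; have := dvdn_leq _ d_i; last by lia.
    by move=> le_k; rewrite (_ : i - k + (k - i) + (2 * k - 1) = 2 * k)%N //; lia.
  apply/orP; case/orP: d_i => d_i; [left|right].
    by rewrite (_ : i + k + 1 = i + (k + 1))%N //; lia.
  by rewrite (_ : i + k + (2 * k - 1) = i + (k - 1) + 2 * k)%N ?dvdn_addK //; lia.
- move=> a le_an d_a; have [lt_ak|le_ka] := ltnP a k.
    apply/andP; split; [apply/andP; split|]; try lia.
    rewrite (_ : 2 * k * Q + (k - 1) + (k + 1) = 2 * k * Q + 2 * k)%N; last by lia.
    by rewrite dvdn_addK dvdn_mulr.
  apply/andP; split; [apply/andP; split|]; try lia.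
  apply/orP; case/orP: d_a => d_a; [left|right].
    by rewrite (_ : a - k + (k + 1) = a + 1)%N //; lia.
  move: d_a; rewrite (_ : a + (2 * k - 1) = a - k + (k - 1) + 2 * k)%N ?dvdn_addK //; lia.
- move=> a a' le_an le_an' d_a d_a'.
  move: (small _ d_a) (small _ d_a') => {d_a d_a' small} small_a small_a'.
  by case: ltnP => [/small_a->|le_ka]; case: ltnP => [/small_a'->|le_ka'] //; lia.
- lia.
- apply/orP; right; rewrite (_ : _ + (k - 1) = 2 * k * Q + 2 * k)%N; last by lia.
  by rewrite dvdn_addK dvdn_mulr.
Qed.

Lemma det_path_mx_eq0 (n : nat) : (1 < k)%N ->
  n != 0 %[mod 2 * k] -> n != k %[mod 2 * k] ->
  n != k + 1 %[mod 2 * k] -> n != 2 * k - 1 %[mod 2 * k] ->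
  \det (path_mx x y t n k%:Z) = 0.
Proof.
move=> k_gt1; rewrite mod0n.
have -> : (k %% (2 * k) = k)%N by rewrite modn_small //; lia.
have -> : ((2 * k - 1) %% (2 * k) = 2 * k - 1)%N by rewrite modn_small //; lia.
have -> : ((k + 1) %% (2 * k) = k + 1)%N by rewrite modn_small //; lia.
move=> n0 nk nk1 n2k; rewrite det_path_mx.
have def_n := divn_eq n (2 * k); rewrite mulnC in def_n.
have lt_r : (n %% (2 * k) < 2 * k)%N by rewrite ltn_pmod //; lia.
(* The remaining residues are 1, ..., k - 1 and k + 2, ..., 2k - 2. *)
have [lt_rk|le_kr] := ltnP (n %% (2 * k)) k.
  by rewrite (det_bordered_low _ def_n) ?mulr0 // lt0n n0.
rewrite (det_bordered_high _ _ def_n) ?mulr0 //; lia.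
Qed.

End Vanishing.

(** * Values of the determinants over an integral domain *)

Section Values.
Variables (R : idomainType) (x y t : R) (k : nat).
Hypotheses (q_neq0 : x * y != 0) (t_neq0 : t != 0).
Local Notation q := (x * y).
Local Notation bmx := (bordered x y t k).
Local Notation G := (gmx x y t k).
Local Notation M n := (path_mx x y t n k%:Z).
Local Notation P m := (Ppol m k x y t).

(** For r = 0 [chain_row] leaves no remainder, so the chain is a kernel vector; its top entry, in
    column c, is 1. *)
Lemma det_bordered0 (N n : nat) (c : 'I_n.+1) : (0 < k)%N ->
  (n <= 2 * k * N + k)%N -> c = (2 * k * N)%N :> nat ->
  \det (bmx n) = P (2 * k * N) * cofactor (G n.+1) ord_max c.
Proof.
move=> k_gt0 le_n def_c; have lt_c := ltn_ord c.
have le_N : (2 * k * N <= n)%N by rewrite -def_c -ltnS.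
have := @det_bordered_kernel _ x y t k n (chain x y t k 0 N) c.
rewrite sum_eval_chain0 // def_c.
have := chain_top x y t 0 N k_gt0; rewrite add0n => ->; rewrite mulr1; apply.
  by move=> a lt_na; rewrite chain_gt // add0n (leq_ltn_trans le_N).
move=> i lt_in; rewrite chain_row; [|lia|lia].
have -> : (i < k)%N && (i + 0 == k)%N = false by lia.
have -> : (i < k)%N && (i + k == 0)%N = false by lia.
by rewrite !mulr0 addr0.
Qed.

(** Each chain alone fails only in row 1, with remainder t q (- t q^k)^N for k + 1 and (- t q^k)^N
    for k - 1; the weight - t q makes these cancel. *)
Lemma det_bordered1 (N n : nat) (c : 'I_n.+1) : (1 < k)%N ->
  (k + 1 + 2 * k * N <= n <= 2 * k * N + 2 * k - 1)%N ->
  \det (bmx n) * (chain x y t k (k + 1) N c - t * q * chain x y t k (k - 1) N c) =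
  (-1) ^+ (k + 1) * P (k + 1 + 2 * k * N) * cofactor (G n.+1) ord_max c.
Proof.
move=> k_gt1 /andP[le_N le_n].
rewrite -(sum_eval_chain1 _ _ _ k_gt1 le_N).
apply: (@det_bordered_kernel _ x y t k n (fun a =>
  chain x y t k (k + 1) N a - t * q * chain x y t k (k - 1) N a)) => [a lt_na|i lt_in].
  by rewrite !chain_gt ?mulr0 ?subrr //; lia.
pose row r := q ^+ (i - k) * chain x y t k r N (i - k + (k - i))
  + t * q ^+ i * chain x y t k r N (i + k).
transitivity (row (k + 1)%N - t * q * row (k - 1)%N); first by rewrite /row; ring.
rewrite /row !chain_row; try lia.
have -> : (i < k)%N && (i + (k + 1) == k)%N = false by lia.
have -> : (i < k)%N && (i + k == k - 1)%N = false by lia.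
have -> : (i < k)%N && (i + k == k + 1)%N = (i == 1%N) by lia.
have -> : (i < k)%N && (i + (k - 1) == k)%N = (i == 1%N) by lia.
by have [->|_] := eqVneq i 1%N; rewrite ?expr1 /=; ring.
Qed.

Lemma det_path_mx_even (N : nat) : (0 < k)%N ->
  \det (M (2 * k * N.+1)) = (-1) ^+ (k * N.+1) * (1 + t) * t ^+ (k * N.+1 - 1)
    * q ^+ (k * N.+1 * (2 * k * N.+1 - k - 1)) * P (2 * k * N.+1).
Proof.
move=> k_gt0; rewrite det_path_mx (det_bordered0 (N := N.+1) (c := ord_max)) ?leq_addr //.
rewrite cofactor_gmx_last det_gmx_even //.
rewrite -signr_odd -mulnA oddM /= expr0 mul1r mulrC; ring.
Qed.

Lemma det_path_mx_odd (N : nat) : (0 < k)%N ->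
  \det (M (2 * k * N + k)) = (-1) ^+ (k * N + k + 'C(k + 1, 2)) * (1 + t) * t ^+ (k * N)
    * q ^+ (k * N * (2 * k * N + k - 1)) * P (2 * k * N).
Proof.
move=> k_gt0; rewrite det_path_mx.
have lt_c : (2 * k * N < (2 * k * N + k).+1)%N by lia.
rewrite (det_bordered0 (N := N) (c := Ordinal lt_c)) //.
have def_n : (k + Ordinal lt_c = 2 * k * N + k)%N by rewrite addnC.
have cof := cofactor_gmx x y t k_gt0 def_n.
suff -> : cofactor (G (2 * k * N + k).+1) ord_max (Ordinal lt_c) =
    (-1) ^+ ('C(k + 1, 2) + k * N) * (1 + t) * t ^+ (k * N)
    * q ^+ (k * N * (2 * k * N + k - 1)).
  have -> : (-1 : R) ^+ (2 * k * N + k) = (-1) ^+ k.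
    by rewrite exprD -mulnA exprM sqrrN expr1n expr1n mul1r.
  rewrite !exprD; ring.
(* [cofactor_gmx] gives this cofactor only up to a power of q, which is cancelled here. *)
apply: (mulfI (expf_neq0 (2 * k * N) q_neq0)); rewrite -[LHS]/(q ^+ Ordinal lt_c * _) cof.
rewrite (_ : (2 * k * N + k).+1 = k + 1 + 2 * k * N)%N; last by lia.
rewrite det_gmx_odd //.
have -> : (k * N * (2 * k * N + k + 1) = 2 * k * N + k * N * (2 * k * N + k - 1))%N by nia.
rewrite [q ^+ (_ + _)]exprD; ring.
Qed.

(** The last column is the top of the chain from k + 1 and lies beyond the other chain, so the
    kernel vector is 1 there. *)
Lemma det_path_mx_odd1 (N : nat) : (1 < k)%N ->
  \det (M (k + 1 + 2 * k * N)) = (-1) ^+ ('C(k + 1, 2) + k * N) * (1 + t) * t ^+ (k * N)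
    * q ^+ (k * N * (2 * k * N + k + 1)) * P (k + 1 + 2 * k * N).
Proof.
move=> k_gt1; have k_gt0 := ltnW k_gt1; rewrite det_path_mx.
have := det_bordered1 (N := N) (n := k + 1 + 2 * k * N) ord_max k_gt1.
rewrite cofactor_gmx_last det_gmx_odd // chain_top // chain_gt /=; last by lia.
rewrite mulr0 subr0 mulr1 => ->; last by lia.
have -> : (-1 : R) ^+ (k + 1 + 2 * k * N) = (-1) ^+ (k + 1).
  by rewrite exprD -mulnA exprM sqrrN expr1n expr1n mulr1.
by rewrite -mulrA signrMK mulrC.
Qed.

(** Column c = n - k is the top of the chain from k - 1, where the kernel vector is - t q. The
    cofactor there is known up to q^c, so both q^c and - t q have to be cancelled. *)
Lemma det_path_mx_even1 (N : nat) : (1 < k)%N ->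
  \det (M (2 * k * N.+1 - 1)) = (-1) ^+ (k * N + 1) * (1 + t) * t ^+ (k * N.+1 - 2)
    * q ^+ (k * N.+1 * (2 * k * N.+1 - k - 1) - (k + 2 * k * N)) * P (k + 1 + 2 * k * N).
Proof.
move=> k_gt1; have k_gt0 := ltnW k_gt1; rewrite det_path_mx.
set n := (2 * k * N.+1 - 1)%N.
have def_n : (n = k + (k - 1 + 2 * k * N))%N by rewrite /n mulnS; lia.
have lt_c : (k - 1 + 2 * k * N < n.+1)%N by lia.
have := det_bordered1 (N := N) (Ordinal lt_c) k_gt1.
rewrite chain_top //=.
(* By [chain_rec] this entry is a multiple of the one 2k further, which is beyond the top. *)
have -> : chain x y t k (k + 1) N (k - 1 + 2 * k * N) = 0.
  have := @chain_rec _ x y t k (k + 1) N (k - 1 + 2 * k * N).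
  rewrite [chain _ _ _ _ _ _ (_ + 2 * k)]chain_gt; last by lia.
  have -> : (k - 1 + 2 * k * N == k + 1 + 2 * k * N)%N = false by lia.
  by rewrite mulr0 addr0; apply; lia.
rewrite sub0r mulr1 => det_b.
have cof := cofactor_gmx x y t k_gt0 (esym def_n : k + Ordinal lt_c = n)%N.
have def_n1 : n.+1 = (2 * k * N.+1)%N by rewrite /n mulnS; lia.
apply: (mulIf (expf_neq0 (k - 1 + 2 * k * N) q_neq0)).
have tq_neq0 : - (t * q) != 0 by rewrite oppr_eq0 mulf_neq0.
apply: (mulIf tq_neq0).
transitivity ((-1) ^+ n * (-1) ^+ (k + 1) * P (k + 1 + 2 * k * N) * \det (G n.+1)).
  rewrite -cof -[(k - 1 + _)%N]/(nat_of_ord (Ordinal lt_c)).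
  transitivity ((-1) ^+ n * (\det (bmx n) * - (t * q)) * q ^+ Ordinal lt_c); first by ring.
  rewrite det_b; last by lia.
  ring.
rewrite def_n1 det_gmx_even //.
have -> : (k * N.+1 - 1 = (k * N.+1 - 2).+1)%N by nia.
set E := (_ - (k + 2 * k * N))%N.
have -> : (k * N.+1 * (2 * k * N.+1 - k - 1) = E + 1 + (k - 1 + 2 * k * N))%N.
  by rewrite /E; nia.
have sgn : (-1) ^+ n * (-1) ^+ (k + 1) * (-1) ^+ (k * N.+1) = - (-1) ^+ (k * N + 1) :> R.
  rewrite -!exprD (_ : (n + (k + 1) + k * N.+1 = k * N + 2 * (k * N + 2 * k))%N).
    by rewrite exprD [_ ^+ (2 * _)]exprM sqrrN !expr1n mulr1 addn1 exprS mulN1r opprK.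
  by rewrite def_n; nia.
rewrite [q ^+ (_ + 1 + _)]exprD [q ^+ (_ + 1)]exprD exprS.
move: sgn; set e1 := _ ^+ n; set e2 := _ ^+ (k + 1); set e3 := _ ^+ (k * N.+1).
set e4 := _ ^+ (k * N + 1) => sgn.
transitivity (e1 * e2 * e3 * (P (k + 1 + 2 * k * N) * ((1 + t) * (t * t ^+ (k * N.+1 - 2))
  * (q ^+ E * q ^+ 1 * q ^+ (k - 1 + 2 * k * N))))); first by ring.
rewrite sgn; ring.
Qed.

(** For k = 0 both columns of row i are i, so [gmx] is diagonal with entries (1 + t) q^i and no row
    i < n meets column n: the indicator of n is a kernel vector. *)
Lemma det_path_mx0 (n : nat) : (0 < n)%N -> k = 0%N ->
  \det (M n) = (1 + t) ^+ n * q ^+ 'C(n, 2) * (x ^+ n + y ^+ n).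
Proof.
move=> n_gt0 k0; rewrite det_path_mx.
have := @det_bordered_kernel _ x y t k n (fun a => (a == n)%:R) ord_max.
rewrite eqxx mulr1 => ->; first 1 last.
- by move=> a lt_na; have -> : (a == n)%N = false by lia.
- move=> i lt_in; rewrite k0; have -> : (i - 0 + (0 - i) == n)%N = false by lia.
  by have -> : (i + 0 == n)%N = false; [lia | rewrite !mulr0 addr0].
rewrite cofactor_gmx_last big_ord_recr big1 /= => [|a _]; last first.
  have -> : (a == n :> nat) = false by have := ltn_ord a; lia.
  by rewrite mulr0.
rewrite eqxx add0r mulr1 /eval_e -[(n == 0)%N]negbK -lt0n n_gt0 /=.
suff -> : \det (G n) = (1 + t) ^+ n * q ^+ 'C(n, 2).
  by rewrite mulrA signrMK mulrC.
have -> : G n = diag_mx (\row_(i < n) ((1 + t) * q ^+ i)).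
  apply/matrixP => i j; rewrite !mxE /gcoef k0 subn0 sub0n !addn0 -val_eqE /= [in RHS]eq_sym.
  by case: eqP => _; rewrite ?mul0r ?mul1r ?mulr0n ?mulr1n ?addr0 // mulrDl mul1r.
rewrite det_diag; under eq_bigr do rewrite mxE.
rewrite big_split prodr_const card_ord /=; congr (_ * _).
by rewrite -expr_sum -(big_mkord xpredT id) bin2_sum.
Qed.

End Values.

(** * The values in the parametrization by n1 *)

Section Cases.
Variables (R : idomainType) (x y t : R).
Hypotheses (q_neq0 : x * y != 0) (t_neq0 : t != 0).
Local Notation q := (x * y).
Local Notation M n k := (path_mx x y t n k%:Z).
Local Notation P m k := (Ppol m k x y t).

Lemma det_path_mx_2kn_sub1 (n k n1 : nat) : (1 < k)%N -> (0 < n1)%N ->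
  n = (2 * k * n1 - 1)%N ->
  \det (M n k) =
    (-1) ^ (k%:Z * (n1%:Z - 1) - 1) * (1 + t) * t ^+ (k * n1 - 2)
    * q ^ (k%:Z * n1%:Z * (2 * k%:Z * n1%:Z - k%:Z - 3) + k%:Z) * P (n - k + 2) k.
Proof.
case: n1 => // n1 k_gt1 _ ->; rewrite det_path_mx_even1 //.
(* The exponent k n1 - 1 is -1 when n1 = 0; adding 2 makes it natural and keeps the sign. *)
have -> : k%:Z * (n1.+1%:Z - 1) - 1 = (k * n1 + 1)%N%:Z + -2 by lia.
rewrite exprzDr ?unitrN1 // -exprnP.
have -> : (-1) ^ (-2) = 1 :> R by rewrite -invr_expz -exprnP sqrrN expr1n invr1.
(* The inner factor may be negative, but the whole exponent is a natural number. *)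
have -> : k%:Z * n1.+1%:Z * (2 * k%:Z * n1.+1%:Z - k%:Z - 3) + k%:Z =
    (k * n1.+1 * (2 * k * n1.+1 - k - 1) - (k + 2 * k * n1))%N%:Z.
  have -> : (2 * k * n1.+1 - k - 1 = 2 * k * n1 + (k - 1))%N by rewrite mulnS; lia.
  rewrite -subzn; last by nia.
  nia.
rewrite -exprnP mulr1; congr (_ * Ppol _ _ _ _ _).
by rewrite mulnS; lia.
Qed.

Lemma det_path_mx_2kn_subk_add1 (n k n1 : nat) : (1 < k)%N -> (0 < n1)%N ->
  n = (2 * k * n1 - k + 1)%N ->
  \det (M n k) =
    (-1) ^+ (k * n1 + 'C(k, 2)) * (1 + t) * t ^+ (k * (n1 - 1))
    * q ^+ (k * (n1 - 1) * (2 * k * n1 - k + 1)) * P n k.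
Proof.
case: n1 => // n1 k_gt1 _ def_n.
have -> : n = (k + 1 + 2 * k * n1)%N by rewrite def_n mulnS; lia.
rewrite det_path_mx_odd1 // subSS subn0.
have -> : (2 * k * n1.+1 - k + 1 = 2 * k * n1 + k + 1)%N by rewrite mulnS; lia.
have -> : ('C(k + 1, 2) + k * n1 = k * n1.+1 + 'C(k, 2))%N.
  by rewrite addn1 binS bin1 mulnS; lia.
by [].
Qed.

Lemma det_path_mx_2kn_subk (n k n1 : nat) : (0 < k)%N -> (0 < n1)%N ->
  n = (2 * k * n1 - k)%N ->
  \det (M n k) =
    (-1) ^+ (k * n1 + 'C(k + 1, 2)) * (1 + t) * t ^+ (k * (n1 - 1))
    * q ^+ (k * (n1 - 1) * (2 * k * n1 - k - 1)) * P (n - k) k.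
Proof.
case: n1 => // n1 k_gt0 _ def_n.
have -> : n = (2 * k * n1 + k)%N by rewrite def_n mulnS; lia.
have -> : (2 * k * n1.+1 - k - 1 = 2 * k * n1 + k - 1)%N by rewrite mulnS; lia.
by rewrite det_path_mx_odd // subSS subn0 addnK mulnS [(k + k * n1)%N]addnC.
Qed.

Lemma det_path_mx_2kn (n k n1 : nat) : (0 < k)%N -> (0 < n1)%N ->
  n = (2 * k * n1)%N ->
  \det (M n k) =
    (-1) ^+ (k * n1) * (1 + t) * t ^+ (k * n1 - 1)
    * q ^+ (k * n1 * (2 * k * n1 - k - 1)) * P n k.
Proof. by case: n1 => // n1 k_gt0 _ ->; exact: det_path_mx_even. Qed.

(** For k = 1 the odd orders are those of the form 2 k n1 - k. *)
Lemma det_path_mx1_odd (n n1 : nat) : (0 < n1)%N -> n = (2 * n1 - 1)%N ->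
  \det (M n 1) =
    (-1) ^+ (n1 + 1) * (1 + t) * t ^+ (n1 - 1)
    * q ^+ (2 * (n1 - 1) ^ 2) * P (n - 1) 1.
Proof.
move=> n1_gt0 def_n.
have binn2 : 'C(1 + 1, 2) = 1%N by [].
rewrite (@det_path_mx_2kn_subk n 1 n1) //.
rewrite binn2 !mul1n muln1; congr (_ * q ^+ _ * _); nia.
Qed.

Lemma det_path_mx1_even (n n1 : nat) : (0 < n1)%N -> n = (2 * n1)%N ->
  \det (M n 1) =
    (-1) ^+ n1 * (1 + t) * t ^+ (n1 - 1) * q ^+ (2 * n1 * (n1 - 1)) * P n 1.
Proof.
move=> n1_gt0 def_n.
rewrite (@det_path_mx_2kn n 1 n1) //.
rewrite !mul1n muln1; congr (_ * q ^+ _ * _); nia.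
Qed.

End Cases.

(* MathComp world.  Powers written ^+ have a natural exponent; powers written ^
   have an integer exponent, computed in int (used where a subterm of the
   exponent can be negative). *)
Theorem theorem11 (n : nat) (hn : (0 < n)%N) :
  (forall k : nat, (2 <= k)%N ->
    [/\ forall n1 : nat, (0 < n1)%N -> n = (2 * k * n1 - 1)%N ->
          \det (path_mx X Y T n k%:Z) =
            (-1) ^ (k%:Z * (n1%:Z - 1) - 1) * (1 + T) * T ^+ (k * n1 - 2)
            * (X * Y) ^ (k%:Z * n1%:Z * (2 * k%:Z * n1%:Z - k%:Z - 3) + k%:Z)
            * Ppol (n - k + 2) k X Y T,
        forall n1 : nat, (0 < n1)%N -> n = (2 * k * n1 - k + 1)%N ->
          \det (path_mx X Y T n k%:Z) =
            (-1) ^+ (k * n1 + 'C(k, 2)) * (1 + T) * T ^+ (k * (n1 - 1))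
            * (X * Y) ^+ (k * (n1 - 1) * (2 * k * n1 - k + 1))
            * Ppol n k X Y T,
        forall n1 : nat, (0 < n1)%N -> n = (2 * k * n1 - k)%N ->
          \det (path_mx X Y T n k%:Z) =
            (-1) ^+ (k * n1 + 'C(k + 1, 2)) * (1 + T) * T ^+ (k * (n1 - 1))
            * (X * Y) ^+ (k * (n1 - 1) * (2 * k * n1 - k - 1))
            * Ppol (n - k) k X Y T,
        forall n1 : nat, (0 < n1)%N -> n = (2 * k * n1)%N ->
          \det (path_mx X Y T n k%:Z) =
            (-1) ^+ (k * n1) * (1 + T) * T ^+ (k * n1 - 1)
            * (X * Y) ^+ (k * n1 * (2 * k * n1 - k - 1))
            * Ppol n k X Y T
      & n != 0 %[mod 2 * k] -> n != k %[mod 2 * k] ->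
        n != k + 1 %[mod 2 * k] -> n != 2 * k - 1 %[mod 2 * k] ->
          \det (path_mx X Y T n k%:Z) = 0])
  /\ ((forall n1 : nat, (0 < n1)%N -> n = (2 * n1 - 1)%N ->
         \det (path_mx X Y T n 1) =
           (-1) ^+ (n1 + 1) * (1 + T) * T ^+ (n1 - 1)
           * (X * Y) ^+ (2 * (n1 - 1) ^ 2) * Ppol (n - 1) 1 X Y T)
      /\ (forall n1 : nat, (0 < n1)%N -> n = (2 * n1)%N ->
         \det (path_mx X Y T n 1) =
           (-1) ^+ n1 * (1 + T) * T ^+ (n1 - 1)
           * (X * Y) ^+ (2 * n1 * (n1 - 1)) * Ppol n 1 X Y T))
  /\ \det (path_mx X Y T n 0) =
       (1 + T) ^+ n * (X * Y) ^+ 'C(n, 2) * (X ^+ n + Y ^+ n).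
Proof.
have X_neq0 i : 'X_i != 0 :> {mpoly int[3]}.
  by apply/eqP => /(congr1 (mcoeff U_(i))); rewrite mcoeffX mcoeff0 eqxx.
have XY_neq0 : X * Y != 0 by rewrite mulf_neq0 ?X_neq0.
have T_neq0 : T != 0 by exact: X_neq0.
split; [move=> k k_gt1; have k_gt0 := ltnW k_gt1; split | split; [split|]].
- by move=> n1; apply: det_path_mx_2kn_sub1.
- by move=> n1; apply: det_path_mx_2kn_subk_add1.
- by move=> n1; apply: det_path_mx_2kn_subk.
- by move=> n1; apply: det_path_mx_2kn.
- exact: det_path_mx_eq0.
- by move=> n1; apply: det_path_mx1_odd.
- by move=> n1; apply: det_path_mx1_even.
exact: det_path_mx0.
Qed.
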